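(* Let $Q_4$ be the $4$-dimensional hypercube with vertex set $\{0,1\}^4$ (two vertices adjacent iff they differ in exactly one coordinate), rooted at $r=(0,0,0,0)$. Let $w^*$ be the weight function on $Q_4$ with $w^*(r)=0$ and $w^*(v)=4$ for every $v\ne r$. Then $w^*$ is a valid weight function on $Q_4$ rooted at $r$.
   Context: A configuration on a graph $G$ is a function $p:V(G)\to\mathbb{N}\cup\{0\}$ ($p(v)$ is the number of pebbles on $v$). A pebbling move from a vertex $u$ to an adjacent vertex $v$ removes two pebbles from $u$ and places one pebble on $v$. For a root $r$, a configuration $p$ is $r$-solvable if some (possibly empty) sequence of pebbling moves starting from $p$ places at least one pebble on $r$; otherwise it is $r$-unsolvable. A weight function is a function $w:V(G)\to\mathbb{R}_{\ge 0}$, and the weight of a configuration is $w(p)=\sum_{v\in V(G)}p(v)w(v)$. $1_G$ denotes the configuration with exactly one pebble on every vertex of $G$, so $w(1_G)=\sum_{v\in V(G)}w(v)$. A weight function $w$ on $G$ rooted at $r$ is valid if $r$ is the only vertex with weight $0$ and every $r$-unsolvable configuration $p$ satisfies $w(p)\le w(1_G)$. *)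

(* Defs.v *)
From HB Require Import structures.
From mathcomp Require Import all_boot all_order all_algebra.
From mathcomp Require Import reals.

Set Implicit Arguments.
Unset Strict Implicit.
Unset Printing Implicit Defensive.

Import Order.TTheory GRing.Theory Num.Theory.
Local Open Scope ring_scope.

Record sgraph := SGraph {
  vertex :> finType;
  adj : rel vertex;
  adj_sym : symmetric adj;
  adj_irr : irreflexive adj }.

Definition config (G : sgraph) := {ffun G -> nat}.

Definition one_config (G : sgraph) : config G := [ffun=> 1%N].

(* The truncated subtraction is exact under the guard [1 < p u] of
   [pebbling_move], and [u != v] since adjacency is irreflexive. *)
Definition move_result (G : sgraph) (p : config G) (u v : G) : config G :=
  [ffun x => (p x - (if x == u then 2 else 0) + (if x == v then 1 else 0))%N].

Definition pebbling_move (G : sgraph) : rel (config G) := fun p q =>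
  [exists u, exists v, [&& adj u v, (1 < p u)%N & q == move_result p u v]].

Definition solvable (G : sgraph) (r : G) (p : config G) : Prop :=
  exists s : seq (config G),
    path (@pebbling_move G) p s /\ (0 < last p s r)%N.

Definition weight (R : realType) (G : sgraph) (w : G -> R) (p : config G) : R :=
  \sum_(v : G) (p v)%:R * w v.

Definition valid_weight (R : realType) (G : sgraph) (r : G) (w : G -> R) : Prop :=
  [/\ forall v, 0 <= w v,
      forall v, w v = 0 <-> v = r
    & forall p : config G, ~ solvable r p -> weight w p <= weight w (one_config G)].

Definition hypercube_adj (n : nat) : rel {ffun 'I_n -> bool} :=
  fun u v => #|[set i | u i != v i]| == 1%N.

Lemma hypercube_adj_sym (n : nat) : symmetric (@hypercube_adj n).
Proof.
move=> u v; rewrite /hypercube_adj; congr (#|pred_of_set _| == _).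
by apply/setP => i; rewrite !inE eq_sym.
Qed.

Lemma hypercube_adj_irr (n : nat) : irreflexive (@hypercube_adj n).
Proof.
move=> u; rewrite /hypercube_adj [X in #|pred_of_set X|](_ : _ = set0) ?cards0 //.
by apply/setP => i; rewrite !inE eqxx.
Qed.

Definition hypercube (n : nat) : sgraph :=
  SGraph (@hypercube_adj_sym n) (@hypercube_adj_irr n).

Definition origin (n : nat) : hypercube n := [ffun=> false].

Definition wstar (R : realType) (v : hypercube 4) : R :=
  if v == origin 4 then 0 else 4%:R.

(* Main.v *)
Require Import Defs.
From mathcomp Require Import all_boot all_order all_algebra.
From mathcomp Require Import reals.
From mathcomp Require Import zify.

Set Implicit Arguments.
Unset Strict Implicit.
Unset Printing Implicit Defensive.

(** This is Chung's theorem that the pebbling number of [Q_n] is [2 ^ n], for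
    [n = 4]: 16 pebbles always suffice to reach the root.  Split [Q_(n+1)] into
    two copies [A] (containing the root [r]) and [B] (containing a neighbour
    [s] of [r]), with [a] and [b] pebbles.  If there are too few pebbles to
    fill [A] up to [2 ^ n] by moving pairs straight across from [B], then many
    vertices of [B] carry an odd number of pebbles.  So one proves
    simultaneously that two pebbles reach the root as soon as the number of
    pebbles plus the number of odd vertices exceeds [2 ^ (n+1)]; two pebbles on
    [s] then give one on [r].  Counting odd vertices (rather than occupied
    ones) makes the second claim stable under moving pairs across. *)

(** * Reachability by pebbling moves *)

Section Reachability.
Variable G : sgraph.
Implicit Types (p q : config G) (A B : {set G}).

Definition reach p q := exists s, path (@pebbling_move G) p s /\ last p s = q.

Lemma reach_refl p : reach p p.
Proof. by exists [::]. Qed.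

Lemma reach_trans p q m : reach p q -> reach q m -> reach p m.
Proof.
case=> s [ps <-] [t [pt <-]]; exists (s ++ t).
by rewrite cat_path last_cat ps.
Qed.

Lemma reach_move p u v : adj u v -> 1 < p u -> reach p (move_result p u v).
Proof.
move=> uv pu; exists [:: move_result p u v]; split=> //=.
rewrite andbT; apply/existsP; exists u; apply/existsP; exists v.
by rewrite uv pu eqxx.
Qed.

Lemma reach_solvable r p q : reach p q -> 0 < q r -> solvable r p.
Proof. by case=> s [ps <-] qr; exists s. Qed.

Lemma adj_neq (u v : G) : adj u v -> u != v.
Proof. by apply: contraTneq => ->; rewrite adj_irr. Qed.

Lemma move_resultE p u v x : u != v ->
  move_result p u v x =
    if x == u then p x - 2 else if x == v then (p x).+1 else p x.
Proof.
move=> uv; rewrite ffunE; case: eqP => [->|_]; first by rewrite (negPf uv) addn0.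
by case: eqP => _; lia.
Qed.

(** * Parity counts and transfers between disjoint sets *)

Definition pebbles A p := \sum_(x in A) p x.
Definition odds A p := \sum_(x in A) odd (p x).
Definition pairs A p := \sum_(x in A) (p x)./2.

Lemma pebblesE A p : pebbles A p = odds A p + (pairs A p).*2.
Proof.
rewrite /pebbles /odds /pairs -muln2 big_distrl -big_split /=.
by apply: eq_bigr => x _; rewrite muln2 odd_double_half.
Qed.

Lemma odds_card A p : odds A p <= #|A|.
Proof. by rewrite -sum1_card leq_sum // => x _; case: odd. Qed.

Lemma odds_le_pebbles A p : odds A p <= pebbles A p.
Proof. by rewrite pebblesE leq_addr. Qed.

Lemma eq_pebbles A p q : {in A, p =1 q} -> pebbles A p = pebbles A q.
Proof. exact: eq_bigr. Qed.

Lemma eq_odds A p q : {in A, forall x, odd (p x) = odd (q x)} ->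
  odds A p = odds A q.
Proof. by move=> e; apply: eq_bigr => x /e ->. Qed.

Lemma pebblesU A B p : [disjoint A & B] ->
  pebbles (A :|: B) p = pebbles A p + pebbles B p.
Proof. by move=> dAB; rewrite /pebbles -bigU //; apply: eq_bigl => x; rewrite !inE. Qed.

Lemma oddsU A B p : [disjoint A & B] ->
  odds (A :|: B) p = odds A p + odds B p.
Proof. by move=> dAB; rewrite /odds -bigU //; apply: eq_bigl => x; rewrite !inE. Qed.

(** Induction on [t], one move along [f] at a time: a move takes two pebbles from a single vertex of
    [B], so no parity in [B] changes and [pairs B] drops by exactly one. *)
Lemma transfer_pairs A B (f : G -> G) : [disjoint A & B] ->
  {in B, forall x, f x \in A /\ adj x (f x)} ->
  forall t p, t <= pairs B p ->
  exists q, [/\ reach p q, pebbles A q = pebbles A p + t,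
    pebbles B q + t.*2 = pebbles B p,
    {in B, forall x, odd (q x) = odd (p x)}
  & forall x, x \notin A :|: B -> q x = p x].
Proof.
move=> dAB fP; elim=> [|t IHt] p tp.
  by exists p; split; rewrite ?addn0 //; exact: reach_refl.
have /exists_inP[b bB pb2]: [exists b in B, 1 < p b].
  apply: contraLR tp; rewrite negb_exists_in => /forall_inP h.
  rewrite -leqNgt /pairs big1 // => x /h; rewrite -leqNgt.
  by case: (p x) => [|[]].
have [fbA bfb] := fP b bB; have nb := adj_neq bfb.
have nA x : x \in A -> x != b.
  by apply: contraTneq => ->; rewrite (disjointFl dAB bB).
have nB x : x \in B -> x != f b.
  by apply: contraTneq => ->; rewrite (disjointFr dAB fbA).
pose m := move_result p b (f b).
have mA : pebbles A m = (pebbles A p).+1.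
  rewrite /pebbles (bigD1 (f b)) //= [in RHS](bigD1 (f b)) //= move_resultE //.
  rewrite eq_sym (negPf nb) eqxx addSn; congr (_ + _).+1.
  apply: eq_bigr => x /andP[xA xfb].
  by rewrite move_resultE // (negPf (nA x xA)) (negPf xfb).
have mBE : {in B, forall x, x != b -> m x = p x}.
  move=> x xB xb.
  by rewrite move_resultE // (negPf xb) (negPf (nB x xB)).
have mb : m b = p b - 2 by rewrite move_resultE // eqxx.
have mB : pebbles B m + 2 = pebbles B p.
  rewrite /pebbles (bigD1 b) //= [in RHS](bigD1 b) //= mb.
  rewrite addnAC subnK //; congr addn.
  by apply: eq_bigr => x /andP[xB xb]; apply: mBE.
have mo : {in B, forall x, odd (m x) = odd (p x)}.
  move=> x xB; have [->|xb] := eqVneq x b; last by rewrite mBE.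
  by rewrite mb oddB // addbF.
(* By [pebblesE], equal [odds] and two fewer pebbles mean one pair fewer. *)
have tm : t <= pairs B m.
  have := eq_odds mo; have := pebblesE B m; have := pebblesE B p; lia.
have [q [mq qA qB qo qn]] := IHt m tm.
exists q; split.
- by apply: reach_trans mq; apply: reach_move.
- by rewrite qA mA; lia.
- by rewrite -mB -qB; lia.
- by move=> x xB; rewrite qo ?mo.
- move=> x xAB; rewrite qn // move_resultE //.
  have [xb|_] := eqVneq x b; first by rewrite xb inE bB orbT in xAB.
  by have [xb|//] := eqVneq x (f b); rewrite xb inE fbA in xAB.
Qed.

(* All moves stay inside [A], so that disjoint sets can be treated in turn. *)
Definition reach_within A r k p :=
  exists q, [/\ reach p q, k <= q r & forall x, x \notin A -> q x = p x].

(** * The doubling step *)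

Definition two_pebbling A r N := forall p,
  (N <= pebbles A p -> reach_within A r 1 p) /\
  (N.*2 < pebbles A p + odds A p -> reach_within A r 2 p).

Lemma reach_within_sub A B r k p : A \subset B ->
  reach_within A r k p -> reach_within B r k p.
Proof.
move=> sAB [q [pq kq qn]]; exists q; split=> // x xB.
by apply: qn; apply: contraNN xB; apply: (subsetP sAB).
Qed.

Lemma reach_within_trans A r k p q : reach p q ->
  (forall x, x \notin A -> q x = p x) ->
  reach_within A r k q -> reach_within A r k p.
Proof.
move=> pq qn [m [qm km mn]]; exists m; split=> //.
- exact: reach_trans qm.
- by move=> x xA; rewrite mn ?qn.
Qed.

Lemma reach_within_step A r s k p : r \in A -> s \in A -> adj s r ->
  k <= p r -> 1 < p s -> reach_within A r k.+1 p.
Proof.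
move=> rA sA sr kp ps; exists (move_result p s r).
have nsr := adj_neq sr; split; first exact: reach_move.
  by rewrite move_resultE // eq_sym (negPf nsr) eqxx.
move=> x xA; rewrite move_resultE //.
have [xs|_] := eqVneq x s; first by rewrite xs sA in xA.
by have [xr|//] := eqVneq x r; rewrite xr rA in xA.
Qed.

(** Write a, b for the pebbles on [A], [B] and o, o' for their odd vertices. Both claims first try
    [A] alone, then use [B] through the matching [f] and the edge from [s] to [r]. *)
Lemma two_pebblingU A B (f : G -> G) r s N :
    [disjoint A & B] -> {in B, forall x, f x \in A /\ adj x (f x)} ->
    #|B| <= N -> r \in A -> s \in B -> adj s r ->
  two_pebbling A r N -> two_pebbling B s N -> two_pebbling (A :|: B) r N.*2.
Proof.
move=> dAB fP cB rA sB sr hA hB p.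
have rAB : r \in A :|: B by rewrite inE rA.
have sAB : s \in A :|: B by rewrite inE sB orbT.
have outA x : x \notin A :|: B -> x \notin A.
  by apply: contraNN => xA; rewrite inE xA.
have outB x : x \notin A :|: B -> x \notin B.
  by apply: contraNN => xB; rewrite inE xB orbT.
have oB := odds_card B p; have oA := odds_le_pebbles A p.
have eB := pebblesE B p.
rewrite pebblesU // oddsU //; split=> hp.
- have [pA|pA] := leqP N (pebbles A p).
    by apply: reach_within_sub (subsetUl A B) _; apply: (hA p).1.
  have [pB|pB] := leqP N (pebbles A p + pairs B p).
    have [|q [pq qA _ _ qn]] :=
      transfer_pairs dAB fP (t := N - pebbles A p) (p := p).
      by lia.
    apply: reach_within_trans pq qn _.
    apply: reach_within_sub (subsetUl A B) _; apply: (hA q).1; lia.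
  (* Here a + [pairs B p] < N while a + b >= 2N, so o' + [pairs B p] > N; doubling gives b + o' >
     2N. *)
  have [|q [pq qs qn]] := (hB p).2; first by lia.
  apply: reach_within_trans pq _ _ => [x /outB /qn //|].
  exact: (reach_within_step rAB sAB sr (leq0n _) qs).
- have [pA|pA] := ltnP N.*2 (pebbles A p + odds A p).
    by apply: reach_within_sub (subsetUl A B) _; apply: (hA p).2.
  (* Top [A] up to N pebbles; the truncated difference is 0 if a >= N already. As o <= a, the
     hypothesis gives a + o' + [pairs B p] > 2N, and o' <= N leaves enough pairs. *)
  have [|q [pq qA qB qo qn]] :=
      transfer_pairs dAB fP (t := N - pebbles A p) (p := p).
    by lia.
  apply: reach_within_trans pq qn _.
  (* If a < N, the count left on [B] is b - 2(N - a) + o', which exceeds 2N since 2a >= a + o. If a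
     >= N, it is b + o', which exceeds 2N since a + o <= 2N. *)
  have [|m [qm ms mn]] := (hB q).2; first by rewrite (eq_odds qo); lia.
  apply: reach_within_trans qm _ _ => [x /outB /mn //|].
  (* Moves inside [A] bring the first pebble to [r] and leave the two on [s], which then supply the
     second. *)
  have [|l [ml lr ln]] := (hA m).1.
    rewrite (@eq_pebbles _ _ q); first by lia.
    by move=> x xA; rewrite mn // (disjointFr dAB xA).
  apply: reach_within_trans ml _ _ => [x /outA /ln //|].
  apply: (reach_within_step rAB sAB sr lr).
  by rewrite ln // (disjointFl dAB sB).
Qed.

Lemma two_pebbling1 r : two_pebbling [set r] r 1.
Proof.
move=> p; rewrite /pebbles /odds !big_set1; split=> hp.
- by exists p; split=> //; exact: reach_refl.
(* A lone pebble is counted twice, giving 2, so the strict bound forces two pebbles. *)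
- by exists p; split=> //; [exact: reach_refl | move: hp; case: (p r) => [|[]]].
Qed.

End Reachability.

(** * Faces of the hypercube and the induction on dimension *)

Section Subcubes.
Variable n : nat.
Implicit Types (k : nat) (c x : hypercube n).

(** The [k]-dimensional face through [c] with the first [k] coordinates free; [c] also serves as its
    root. *)
Definition subcube k c : {set hypercube n} :=
  [set x : {ffun 'I_n -> bool} | [forall i : 'I_n, (k <= i) ==> (x i == c i)]].

Lemma subcubeP k c x :
  reflect (forall i : 'I_n, k <= i -> x i = c i) (x \in subcube k c).
Proof.
rewrite inE; apply: (iffP forallP) => h i.
- by move=> ki; apply/eqP; have := h i; rewrite ki.
- by apply/implyP => ki; apply/eqP/h.
Qed.

Definition flip (i : 'I_n) x : hypercube n := [ffun j => (j == i) (+) x j].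

Lemma adj_flip i x : adj x (flip i x).
Proof.
rewrite /= /hypercube_adj (_ : [set _ | _] = [set i]) ?cards1 //.
by apply/setP => j; rewrite !inE ffunE; case: (j == i); case: (x j).
Qed.

Lemma flip_subcube k (kn : k < n) c x :
  (flip (Ordinal kn) x \in subcube k c) = (x \in subcube k (flip (Ordinal kn) c)).
Proof.
apply/subcubeP/subcubeP => h i /h; rewrite !ffunE.
- by move=> <-; rewrite addKb.
- by move=> ->; rewrite addKb.
Qed.

Lemma subcubeS k (kn : k < n) c :
  subcube k.+1 c = subcube k c :|: subcube k (flip (Ordinal kn) c).
Proof.
apply/setP => x; rewrite in_setU; apply/subcubeP/orP.
- move=> h; have hi (i : 'I_n) : k <= i -> i != Ordinal kn -> k < i.
    by move=> ki; rewrite ltn_neqAle ki andbT eq_sym;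
      apply: contraNneq => e; apply/eqP/val_inj.
  have [e|ne] := eqVneq (x (Ordinal kn)) (c (Ordinal kn)); [left|right].
  + apply/subcubeP => i ki.
    by have [->//|/(hi i ki)/h] := eqVneq i (Ordinal kn).
  + apply/subcubeP => i ki; rewrite ffunE.
    have [->|/(hi i ki)/h ->//] := eqVneq i (Ordinal kn).
    by move: ne; case: (x _); case: (c _).
- case=> /subcubeP h i ki.
    by rewrite h // ltnW.
  rewrite h ?ffunE 1?ltnW //; case: eqP => // e.
  by rewrite e ltnn in ki.
Qed.

Lemma disjoint_subcube k (kn : k < n) c :
  [disjoint subcube k c & subcube k (flip (Ordinal kn) c)].
Proof.
rewrite disjoint_subset; apply/subsetP => x /subcubeP h; rewrite inE.
apply/negP => /subcubeP /(_ (Ordinal kn) (leqnn _)); rewrite h ?leqnn //.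
by rewrite ffunE eqxx; case: (c _).
Qed.

Lemma subcube0 c : subcube 0 c = [set c].
Proof.
apply/setP => x; apply/subcubeP/set1P => [h|-> //].
by apply/ffunP => i; apply: h.
Qed.

Lemma card_subcube k c : k <= n -> #|subcube k c| = 2 ^ k.
Proof.
elim: k c => [|k IHk] c kn; first by rewrite subcube0 cards1.
rewrite (subcubeS kn) cardsU disjoint_setI0 ?disjoint_subcube // cards0 subn0.
by rewrite !IHk ?(ltnW kn) // addnn -mul2n expnS.
Qed.

Lemma subcube_two_pebbling k c : k <= n -> two_pebbling (subcube k c) c (2 ^ k).
Proof.
elim: k c => [|k IHk] c kn; first by rewrite subcube0; apply: two_pebbling1.
rewrite (subcubeS kn) expnS mul2n.
have self d : d \in subcube k d by apply/subcubeP.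
(* Flipping coordinate [k] matches the two halves and carries the root [c] to its neighbour [s], the
   root of the other half. *)
apply: (@two_pebblingU _ _ _ (flip (Ordinal kn)) _ (flip (Ordinal kn) c)).
- exact: disjoint_subcube.
- by move=> x; rewrite -flip_subcube; split=> //; apply: adj_flip.
- by rewrite card_subcube // ltnW.
- exact: self.
- exact: self.
- by rewrite adj_sym adj_flip.
- by apply: IHk; apply: ltnW.
- by apply: IHk; apply: ltnW.
Qed.

Lemma hypercube_solvable c (p : config (hypercube n)) :
  2 ^ n <= \sum_x p x -> solvable c p.
Proof.
have cT : subcube n c = setT.
  by apply/setP => x; rewrite in_setT; apply/subcubeP => i; rewrite leqNgt ltn_ord.
move=> hp; have [|q [pq qc _]] := (subcube_two_pebbling c (leqnn n) p).1.
  by rewrite cT /pebbles (eq_bigl predT) // => x; rewrite in_setT.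
exact: reach_solvable pq qc.
Qed.

End Subcubes.

(** * Validity of the weight function *)

Import Order.TTheory GRing.Theory Num.Theory.
Local Open Scope ring_scope.

Lemma weight_wstar_one (R : realType) :
  weight (@wstar R) (one_config (hypercube 4)) = 15%:R * 4%:R.
Proof.
rewrite /weight (bigD1 (origin 4)) //= /wstar eqxx mulr0 add0r.
rewrite (eq_bigr (fun=> 4%:R)).
  by rewrite sumr_const cardC1 card_ffun card_bool card_ord mulr_natl.
by move=> v /negPf ->; rewrite ffunE mul1r.
Qed.

Theorem theorem2 (R : realType) : valid_weight (origin 4) (@wstar R).
Proof.
split=> [v|v|p np].
- by rewrite /wstar; case: ifP => _; rewrite ?ler0n.
- rewrite /wstar; case: eqP => [-> //|ne]; split=> // /eqP.
  by rewrite pnatr_eq0.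
(* An unsolvable configuration has fewer than 2^4 pebbles, hence at most as many as there are
   non-root vertices, and each weighs at most 4. *)
have lep : (\sum_v p v <= 15)%N.
  by rewrite -ltnS ltnNge; apply/negP => /(hypercube_solvable (origin 4)) /np.
rewrite weight_wstar_one.
apply: (@le_trans _ _ ((\sum_v p v)%:R * 4%:R)); last first.
  by rewrite ler_wpM2r ?ler0n // ler_nat.
rewrite natr_sum mulr_suml; apply: ler_sum => v _.
by rewrite ler_wpM2l ?ler0n // /wstar; case: ifP => _; rewrite ?ler0n.
Qed.
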